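(* For every integer $n\geq 2$, $$a_n(3412,4321;213)=a_n(3412,4321;312)=P_{n-1},$$ where $P_m$ is the $m$-th Pell number.
   Context: A permutation $\pi$ of $[n]=\{1,\dots,n\}$ is cyclic if it consists of a single $n$-cycle. Its one-line notation is $\pi_1\pi_2\cdots\pi_n$ with $\pi_i=\pi(i)$. Its standard cycle form is $(c_1,c_2,\dots,c_n)$ with $c_1=1$ and $c_{i+1}=\pi(c_i)$ for $1\le i<n$. A sequence $w_1\cdots w_n$ of distinct integers contains a pattern $\sigma=\sigma_1\cdots\sigma_k\in S_k$ if there are indices $i_1<\dots<i_k$ with $w_{i_s}>w_{i_t}$ iff $\sigma_s>\sigma_t$ for all $s<t$; otherwise it avoids $\sigma$. $\mathcal{A}_n(\sigma_1,\dots,\sigma_l;\rho)$ is the set of cyclic permutations of $[n]$ whose one-line notation avoids each $\sigma_i$ and whose standard cycle form $c_1\cdots c_n$, read as a sequence, avoids $\rho$; $a_n(\sigma_1,\dots,\sigma_l;\rho)$ is its cardinality. Pell numbers: $P_0=0$, $P_1=1$, $P_m=2P_{m-1}+P_{m-2}$ for $m\ge 2$. *)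

(* Defs.v *)
From mathcomp Require Import all_boot all_fingroup.

Set Implicit Arguments.
Unset Strict Implicit.
Unset Printing Implicit Defensive.

(* Permutations of [n] = {1, ..., n} are elements of 'S_n, which act on
   {0, ..., n-1}; words and patterns are sequences of naturals written with
   the letters 1, ..., n. *)

Definition contains (sigma w : seq nat) : bool :=
  [exists i : {ffun 'I_(size sigma) -> 'I_(size w)},
    [forall s : 'I_(size sigma), forall t : 'I_(size sigma), (s < t) ==>
      ((i s < i t) &&
       ((nth 0 w (i s) > nth 0 w (i t))
          == (nth 0 sigma s > nth 0 sigma t)))]].

Definition avoids (sigma w : seq nat) : bool := ~~ contains sigma w.

Definition is_cyclic n (p : 'S_n) : bool := #|porbits p| == 1.

Definition one_line n (p : 'S_n) : seq nat :=
  [seq (val (p i)).+1 | i <- enum 'I_n].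

(* For cyclic p, this lists c_1 = 1 and c_{i+1} = p(c_i) for i < n. *)
Definition cycle_form n : 'S_n -> seq nat :=
  match n with
  | 0 => fun _ => [::]
  | m.+1 => fun p => [seq (val i).+1 | i <- traject p ord0 m.+1]
  end.

Definition A_set n (sigmas : seq (seq nat)) (rho : seq nat) : {set 'S_n} :=
  [set p : 'S_n | [&& is_cyclic p,
                      all (fun sigma => avoids sigma (one_line p)) sigmas
                    & avoids rho (cycle_form p)]].

Definition a_num n (sigmas : seq (seq nat)) (rho : seq nat) : nat :=
  #|A_set n sigmas rho|.

Fixpoint pell (m : nat) : nat :=
  match m with
  | 0 => 0
  | 1 => 1
  | (k.+1 as l).+1 => 2 * pell l + pell k
  end.

(* Main.v *)
Require Import Defs.
From mathcomp Require Import all_boot all_fingroup.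
From mathcomp Require Import zify.

(* Inversion preserves 3412 and 4321 in the one-line notation and reverses the
   cycle form after its leading 1, so it exchanges 213 and 312.

   For 312, consider more generally cycles (a, Y) where Y rearranges
   b, b+1, ..., b+m-1 and a < b, and look at the letter b. If b is first in Y,
   deleting a leaves a cycle of the same kind; if b is last in Y, delete b. If b
   is strictly inside Y, then avoiding 312 makes every letter before b smaller
   than every letter after it, and avoiding 3412 and 4321 forces
   Y = b+1, b, Y'; deleting a and b leaves (b+1, Y') with Y' nonempty. Each
   deletion preserves and reflects the avoidance conditions, which gives the
   Pell recurrence. *)

Set Implicit Arguments.
Unset Strict Implicit.
Unset Printing Implicit Defensive.

(** * Cycles as words, and the avoidance conditions on them *)

Definition avoids_312 (c : seq nat) : Prop :=
  forall x y z, subseq [:: x; y; z] c -> ~ (y < z /\ z < x).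

(** [D] lists the positions and [f] gives the values. Taking positions from a word rather than an
    interval lets the condition apply to cycles on any set of letters, such as those left after
    deletions. *)
Definition avoids_3412_4321 (D : seq nat) (f : nat -> nat) : Prop :=
  forall x1 x2 x3 x4, x1 \in D -> x2 \in D -> x3 \in D -> x4 \in D ->
  x1 < x2 -> x2 < x3 -> x3 < x4 ->
  ~ (f x3 < f x4 /\ f x4 < f x1 /\ f x1 < f x2) /\
  ~ (f x4 < f x3 /\ f x3 < f x2 /\ f x2 < f x1).

(** [next c] is the permutation with cycle [c]; its values on the letters of [c] in increasing order
    are its one-line notation. *)
Definition good_cycle (c : seq nat) : Prop :=
  avoids_312 c /\ avoids_3412_4321 c (next c).

(** The default [a] of [nth] encodes the return from the last letter to the head. *)
Lemma next_cons (a : nat) s z :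
  z \in a :: s -> next (a :: s) z = nth a s (index z (a :: s)).
Proof. by rewrite next_nth => ->. Qed.

Lemma next_adjacent (s1 s2 : seq nat) u v :
  uniq (s1 ++ u :: v :: s2) -> next (s1 ++ u :: v :: s2) u = v.
Proof.
move=> U; rewrite -(next_rot (size s1) U) rot_size_cat next_nth mem_head /=.
by rewrite eqxx.
Qed.

Lemma next_last (a : nat) s x :
  uniq (a :: rcons s x) -> next (a :: rcons s x) x = a.
Proof.
move=> U; rewrite -(next_rotr 1 U) -rcons_cons rotr1_rcons.
by apply: (@next_adjacent [::] s x a); move: U; rewrite -rcons_cons rcons_uniq.
Qed.

(* Since [a], [b] are smaller than all other values, exchanging the value [a]
   for [b] does not affect order comparisons. *)
Definition relabel (a b u v : nat) : Prop :=
  (u = a /\ v = b) \/ (u = v /\ a < v /\ b < v).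

Lemma relabel_ltn a b u v u' v' :
  relabel a b u v -> relabel a b u' v' -> (u < u') = (v < v').
Proof. rewrite /relabel; lia. Qed.

Lemma relabel_src a b u v : relabel a b u v -> u = a \/ b < u.
Proof. rewrite /relabel; lia. Qed.

Lemma relabel_pattern a b u1 u2 u3 u4 v1 v2 v3 v4 :
  relabel a b u1 v1 -> relabel a b u2 v2 ->
  relabel a b u3 v3 -> relabel a b u4 v4 ->
  (~ (u3 < u4 /\ u4 < u1 /\ u1 < u2) /\ ~ (u4 < u3 /\ u3 < u2 /\ u2 < u1)) <->
  (~ (v3 < v4 /\ v4 < v1 /\ v1 < v2) /\ ~ (v4 < v3 /\ v3 < v2 /\ v2 < v1)).
Proof.
move=> e1 e2 e3 e4.
by rewrite !(relabel_ltn e3 e4, relabel_ltn e4 e1, relabel_ltn e1 e2,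
             relabel_ltn e4 e3, relabel_ltn e3 e2, relabel_ltn e2 e1).
Qed.

(** * Effect of the deletions on the successor map *)

(** Only the last letter of the cycle notices the deletion of [a]: its successor [a] becomes [b]. *)
Lemma next_del_first (a b : nat) X z :
  a < b -> all (ltn b) X -> uniq X -> z \in b :: X ->
  relabel a b (next (a :: b :: X) z) (next (b :: X) z).
Proof.
move=> ab /allP bX U zX.
have za : z != a.
  by move: zX; rewrite inE => /orP[/eqP->|/bX /=]; lia.
rewrite !next_cons ?(in_cons a) ?zX ?orbT //.
have -> : index z (a :: b :: X) = (index z (b :: X)).+1 by rewrite /= eq_sym (negPf za).
set i := index _ _; rewrite [nth a _ _]/=.
case: (ltnP i (size X)) => h.
  right; rewrite (set_nth_default b) //; have /bX /= : nth b X i \in X by rewrite mem_nth.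
  by move: ab; clear; lia.
by left; rewrite !nth_default.
Qed.

(** Only the letter just before [b] changes successor, from [b] to [a]. *)
Lemma next_del_last (a b : nat) X z :
  a < b -> all (ltn b) X -> uniq X -> z \in a :: X ->
  relabel b a (next (a :: rcons X b) z) (next (a :: X) z).
Proof.
move=> ab /allP bX U zX.
rewrite !next_cons // -?rcons_cons ?mem_rcons ?(in_cons b) ?zX ?orbT //.
have -> : index z (rcons (a :: X) b) = index z (a :: X).
  by rewrite -cats1 index_cat zX.
have : index z (a :: X) < (size X).+1 by rewrite -[(size X).+1]/(size (a :: X)) index_mem.
set i := index _ _ => hi; rewrite nth_rcons.
case: (ltnP i (size X)) => h.
  right; have /bX /= : nth a X i \in X by rewrite mem_nth.
  by move: ab; clear; lia.
have -> : i = size X by lia.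
by rewrite eqxx; left; rewrite nth_default.
Qed.

(** Within [X] only the last letter changes successor, from [a] to [b.+1]. *)
Lemma next_del_pair (a b : nat) X z :
  a < b -> all (ltn b.+1) X -> uniq X -> z \in X ->
  relabel a b.+1 (next (a :: b.+1 :: b :: X) z) (next (b.+1 :: X) z).
Proof.
move=> ab bX U zX; have bz : b.+1 < z := allP bX _ zX.
rewrite !next_cons ?in_cons ?zX ?orbT //=.
have [-> -> ->] : [/\ a == z = false, b.+1 == z = false & b == z = false] by split; lia.
case: (ltnP (index z X).+1 (size X)) => h.
  right; rewrite (set_nth_default b.+1) //.
  have /(allP bX) /= : nth b.+1 X (index z X).+1 \in X by rewrite mem_nth.
  by move: ab; clear; lia.
by left; rewrite !nth_default.
Qed.

(** * Effect of the deletions on 312 *)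

Lemma avoids_312_cons (a : nat) s :
  all (ltn a) s -> avoids_312 (a :: s) <-> avoids_312 s.
Proof.
move=> /allP as_; split=> h x y z sub.
  by apply: h; apply: subseq_trans sub (subseq_cons _ _).
move: sub => /=; case: eqP => [->|_]; last exact: h.
move=> /mem_subseq sub; have /as_ /= : y \in s by apply: sub; rewrite mem_head.
lia.
Qed.

(** Being last, [b] could only play the 2; the only smaller letter is [a], which comes first and so
    cannot play the 1. *)
Lemma avoids_312_rcons (a b : nat) X :
  a < b -> all (ltn b) X -> avoids_312 (a :: rcons X b) <-> avoids_312 (a :: X).
Proof.
move=> ab bX.
have H : all (ltn a) (rcons X b).
  by rewrite all_rcons /= ab; apply: sub_all bX => x /=; lia.
have H' : all (ltn a) X by apply: sub_all bX => x /=; lia.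
rewrite !avoids_312_cons //; split=> h x y z sub.
  by apply: h; apply: subseq_trans sub (subseq_rcons _ _).
have [zb|zb] := eqVneq z b.
  have ys : y \in rcons X b by apply: (mem_subseq sub); rewrite !inE eqxx orbT.
  move: ys; rewrite mem_rcons inE => /orP[/eqP->|/(allP bX) /=]; lia.
apply: h; rewrite -subseq_rev; move: sub; rewrite -subseq_rev rev_rcons.
by rewrite -[rev [:: x; y; z]]/[:: z; y; x] /= (negPf zb).
Qed.

(** As a 3, [b] is followed only by larger letters. As a 1, it needs [b.+1] as the 3, but every
    later letter exceeds [b.+1]. *)
Lemma avoids_312_pair (a b : nat) X :
  a < b -> all (ltn b.+1) X ->
  avoids_312 (a :: b.+1 :: b :: X) <-> avoids_312 (b.+1 :: X).
Proof.
move=> ab bX.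
rewrite avoids_312_cons; last first.
  by rewrite /= ab ltnS (ltnW ab) /=; apply: sub_all bX => x /=; lia.
split=> h x y z sub.
  apply: h; apply: subseq_trans sub _.
  exact: (cat_subseq (subseq_refl [:: b.+1]) (subseq_cons X b)).
move: sub => /=; case: eqP => [->|xb].
  case: eqP => [->|yb] sub.
    have : z \in X by apply: (mem_subseq sub); rewrite mem_head.
    by move/(allP bX) => /=; lia.
  by apply: h; rewrite /= eqxx.
case: eqP => [->|xb'] sub.
  have : y \in X by apply: (mem_subseq sub); rewrite mem_head.
  by move/(allP bX) => /=; lia.
by apply: h => /=; case: eqP xb.
Qed.

(** * The three deletions preserve and reflect goodness *)

(** In a pattern the smallest letter [a] can only be [x1]. Its value [b] exceeds no value but [a],
    whereas both patterns need two values, at [x3] and [x4], below that at [x1]. *)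
Lemma good_cycle_first (a b : nat) X :
  a < b -> all (ltn b) X -> uniq X ->
  good_cycle (a :: b :: X) <-> good_cycle (b :: X).
Proof.
move=> ab bX U; rewrite /good_cycle avoids_312_cons; last first.
  by rewrite /= ab; apply: sub_all bX => x /=; lia.
have nextE z := @next_del_first a b X z ab bX U.
have nexta : next (a :: b :: X) a = b by rewrite /= eqxx.
move: (next (a :: _)) (next (b :: X)) nextE nexta => f f' nextE fa.
have bD z : z \in b :: X -> a < z.
  by rewrite inE => /orP[/eqP->|/(allP bX) /=]; lia.
split=> -[h1 h2]; split=> // x1 x2 x3 x4 D1 D2 D3 D4 l1 l2 l3.
  apply/(relabel_pattern (nextE _ D1) (nextE _ D2) (nextE _ D3) (nextE _ D4)).
  by refine (h2 _ _ _ _ _ _ _ _ l1 l2 l3); rewrite in_cons; apply/orP; right.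
have D' z : z \in a :: b :: X -> a < z -> z \in b :: X.
  by rewrite in_cons => /orP[/eqP->|//]; rewrite ltnn.
have aD z : z \in a :: b :: X -> z = a \/ a < z.
  by rewrite in_cons => /orP[/eqP->|/bD]; [left | right].
have l : a < x2 by case: (aD _ D1) => [<- //|l0]; apply: ltn_trans l1.
have D2' := D' _ D2 l; have D3' := D' _ D3 (ltn_trans l l2).
have D4' := D' _ D4 (ltn_trans (ltn_trans l l2) l3).
case: (aD _ D1) => [x1a|/(D' _ D1) D1'].
  move: fa ab (relabel_src (nextE _ D3')) (relabel_src (nextE _ D4')).
  by rewrite x1a; clear; lia.
apply/(relabel_pattern (nextE _ D1') (nextE _ D2') (nextE _ D3') (nextE _ D4')).
exact: h2 l1 l2 l3.
Qed.

(** Only [a] lies below [b], so in a pattern [b] can only be [x1] or [x2]. Its value [a] is the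
    minimum, whereas both patterns have smaller values later. *)
Lemma good_cycle_last (a b : nat) X :
  a < b -> all (ltn b) X -> uniq X ->
  good_cycle (a :: rcons X b) <-> good_cycle (a :: X).
Proof.
move=> ab bX U; rewrite /good_cycle avoids_312_rcons //.
have nextE z := @next_del_last a b X z ab bX U.
have nextb : next (a :: rcons X b) b = a.
  apply: next_last; rewrite /= mem_rcons inE rcons_uniq U andbT.
  rewrite negb_or -andbA; apply/and3P; split; first by lia.
    by apply/negP => /(allP bX) /=; lia.
  by apply/negP => /(allP bX) /=; lia.
move: (next (a :: rcons _ _)) (next (a :: X)) nextE nextb => f f' nextE fb.
have inD z : z \in a :: rcons X b = (z == b) || (z \in a :: X).
  by rewrite -rcons_cons mem_rcons in_cons.
have aD z : z \in a :: rcons X b -> z = a \/ b <= z.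
  rewrite inD in_cons => /or3P[/eqP->|/eqP->|/(allP bX) /= /ltnW]; first by right.
    by left.
  by right.
split=> -[h1 h2]; split=> // x1 x2 x3 x4 D1 D2 D3 D4 l1 l2 l3.
  apply/(relabel_pattern (nextE _ D1) (nextE _ D2) (nextE _ D3) (nextE _ D4)).
  by refine (h2 _ _ _ _ _ _ _ _ l1 l2 l3); rewrite inD; apply/orP; right.
have D' z : z \in a :: rcons X b -> z != b -> z \in a :: X.
  by rewrite inD => /orP[->|].
have [x3b x4b] : x3 != b /\ x4 != b.
  by move: (aD _ D1) (aD _ D2) ab l1 l2 l3; clear; lia.
have D3' := D' _ D3 x3b; have D4' := D' _ D4 x4b.
have := relabel_src (nextE _ D3'); have := relabel_src (nextE _ D4').
have [x1b|x1b] := eqVneq x1 b; first by rewrite x1b fb; move: ab; clear; lia.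
have [x2b|x2b] := eqVneq x2 b; first by rewrite x2b fb; move: ab; clear; lia.
have D1' := D' _ D1 x1b; have D2' := D' _ D2 x2b => _ _.
apply/(relabel_pattern (nextE _ D1') (nextE _ D2') (nextE _ D3') (nextE _ D4')).
exact: h2 l1 l2 l3.
Qed.

(* Letter [b.+1] of the shorter cycle corresponds to letter [b] of the longer
   one: both are followed by the head of [X]. *)
Lemma good_cycle_pair (a b : nat) X :
  a < b -> all (ltn b.+1) X -> uniq X -> X != [::] ->
  good_cycle (a :: b.+1 :: b :: X) <-> good_cycle (b.+1 :: X).
Proof.
move=> ab bX U X0; rewrite /good_cycle avoids_312_pair //.
set f := next (a :: _); set f' := next (b.+1 :: X).
have nextE z : z \in X -> relabel a b.+1 (f z) (f' z) by apply: next_del_pair.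
have fa : f a = b.+1 by rewrite /f /= eqxx.
have fb1 : f b.+1 = b.
  by rewrite /f /= eqxx; case: eqP => //; lia.
have [fb f'b] : f b = f' b.+1 /\ b.+1 < f' b.+1.
  rewrite /f /f'; case: X X0 bX {U f f' nextE fa fb1} => //= u X _ /andP[bu _].
  by rewrite !eqxx; have [-> ->] : b == a = false /\ b == b.+1 = false by lia.
move: f f' nextE fa fb1 fb f'b => f f' nextE fa fb1 fb f'b.
have bD z : z \in X -> b.+1 < z by move/(allP bX).
have relb : relabel a b.+1 (f b) (f' b.+1).
  by right; move: fb f'b ab; clear; lia.
(* [g] is this correspondence of letters; being increasing, it carries a pattern of the shorter
   cycle to one of the longer. *)
pose g z := if z == b.+1 then b else z.
have gE z : z \in b.+1 :: X ->
    g z \in a :: b.+1 :: b :: X /\ relabel a b.+1 (f (g z)) (f' z).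
  rewrite /g inE; case: eqP => [-> _|nz /= zX]; first by rewrite !inE eqxx !orbT.
  by rewrite !inE zX !orbT; split=> //; apply: nextE.
have g_lt x y : b.+1 <= x -> x < y -> g x < g y.
  by rewrite /g; case: eqP; case: eqP; clear; lia.
have geD x : x \in b.+1 :: X -> b.+1 <= x by rewrite inE => /orP[/eqP->|/bD /ltnW].
split=> -[h1 h2]; split=> // x1 x2 x3 x4 D1 D2 D3 D4 l1 l2 l3.
  have [m1 e1] := gE _ D1; have [m2 e2] := gE _ D2.
  have [m3 e3] := gE _ D3; have [m4 e4] := gE _ D4.
  apply/(relabel_pattern e1 e2 e3 e4).
  by refine (h2 _ _ _ _ m1 m2 m3 m4 _ _ _); apply: g_lt => //; apply: geD.
have xE x : x \in a :: b.+1 :: b :: X ->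
   [\/ x = a, x = b.+1, x = b | [/\ x \in X, b.+1 < x & f x = a \/ b.+1 < f x]].
  rewrite !inE => /or4P[/eqP->|/eqP->|/eqP->|xX].
  - by constructor 1.
  - by constructor 2.
  - by constructor 3.
  by constructor 4; split=> //; [apply: bD | apply: relabel_src (nextE _ xX)].
have small y : y \in a :: b.+1 :: b :: X -> f y < b -> f y = a.
  move/xE => [->|->|->|[_ _ []//]]; rewrite ?fa ?fb1 ?fb; move: f'b; clear; lia.
(* Below [f a = b.+1] there are only the values [a] and [b], too few for 4321. A 3412 needs
   [f x3 = a] and [f x4 = b], so [x4 = b.+1]; but a letter with value [a] exceeds [b], so [x3 < x4]
   fails. *)
have [x1a|x1a] := eqVneq x1 a.
  rewrite x1a fa.
  have fx4 : f x4 = b -> x4 = b.+1.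
    by case: (xE _ D4) => [->|//|->|[_ _ +]]; rewrite ?fa ?fb; move: ab f'b; clear; lia.
  have fx3 : f x3 = a -> b < x3.
    by case: (xE _ D3) => [->|->//|->|[_ + _]]; rewrite ?fa ?fb; move: ab f'b; clear; lia.
  by move: (small _ D2) (small _ D3) (small _ D4) fx3 fx4 l3; clear; lia.
have ge x : x \in a :: b.+1 :: b :: X -> x = a \/ b <= x.
  by move/xE => [->|->|->|[_ ? _]]; [left|right|right|right] => //; lia.
have bx1 : b <= x1 by case: (ge _ D1) x1a => [->|//]; rewrite eqxx.
have inX x : x \in a :: b.+1 :: b :: X -> b.+1 < x -> x \in X.
  by move/xE => [->|->|->|[//]]; move: ab; clear; lia.
have X3 : x3 \in X by apply: inX => //; move: bx1 l1 l2; clear; lia.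
have X4 : x4 \in X by apply: inX => //; move: bx1 l1 l2 l3; clear; lia.
have r3 := relabel_src (nextE _ X3); have r4 := relabel_src (nextE _ X4).
(* The value [b] at [b.+1] exceeds no value but [a], whereas [x1] and [x2] each need two smaller
   values, at [x3] and [x4]. *)
have [x1b|x1b] := eqVneq x1 b.+1.
  by rewrite x1b fb1; move: r3 r4 ab; clear; lia.
have [x2b|x2b] := eqVneq x2 b.+1.
  by rewrite x2b fb1; move: r3 r4 ab; clear; lia.
have X2 : x2 \in X by apply: inX => //; move: bx1 l1 x2b; clear; lia.
have inS x : x \in X -> x \in b.+1 :: X by rewrite in_cons => ->; rewrite orbT.
case: (xE _ D1) => [x1E|x1E|x1E|[X1 _ _]]; rewrite ?x1E ?eqxx // in x1a x1b *.
  apply/(relabel_pattern relb (nextE _ X2) (nextE _ X3) (nextE _ X4)).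
  by refine (h2 _ _ _ _ _ _ _ _ _ l2 l3); rewrite ?mem_head ?inS // bD.
apply/(relabel_pattern (nextE _ X1) (nextE _ X2) (nextE _ X3) (nextE _ X4)).
by refine (h2 _ _ _ _ _ _ _ _ l1 l2 l3); rewrite inS.
Qed.

(* If [b] is neither second nor last, then avoiding 312 splits the cycle as
   [a, pre, b, post] with [pre < post]; the values at [a], [b], the last letter
   of [pre] and the last letter of [post] then leave no room for a second
   letter in [pre]. *)
Lemma good_cycle_middle (a b : nat) pre post :
  a < b -> all (ltn b) (pre ++ post) -> uniq (pre ++ post) ->
  pre != [::] -> post != [::] -> good_cycle (a :: pre ++ b :: post) ->
  size pre = 1 /\ (forall x y, x \in pre -> y \in post -> x < y).
Proof.
move=> ab; rewrite all_cat => /andP[/allP bpre /allP bpost] U pre0 post0 [h1 h2].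
have sep x y : x \in pre -> y \in post -> x < y.
  move=> xp yp; have := h1 x b y.
  have -> : subseq [:: x; b; y] (a :: pre ++ b :: post).
    apply: subseq_trans (subseq_cons _ a).
    by rewrite -(cat1s x) cat_subseq //= ?sub1seq // eqxx sub1seq.
  have : x != y.
    apply/eqP => xy; move: U; rewrite cat_uniq => /and3P[_ /hasPn /(_ _ yp)].
    by rewrite /= -xy xp.
  by have := bpost _ yp => /=; lia.
split=> //.
have Uc : uniq (a :: pre ++ b :: post).
  rewrite /= mem_cat inE -cat_rcons -cats1 -catA.
  have -> : uniq (pre ++ [:: b] ++ post) = uniq ([:: b] ++ pre ++ post).
    exact: uniq_catCA.
  rewrite /= U andbT mem_cat !negb_or.
  have [-> /= ->] : (a \notin pre) /\ (a \notin post).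
    by split; apply/negP; [move/bpre|move/bpost] => /=; lia.
  rewrite (ltn_eqF ab) /=.
  by apply/andP; split; apply/negP; [move/bpre|move/bpost] => /=; lia.
case: pre pre0 => // h pre' _ in bpre U h1 h2 sep Uc *.
case/lastP: pre' => [//|r x] in bpre U h1 h2 sep Uc *; exfalso.
case: post post0 => // q post' _ in bpost U h1 h2 sep Uc *.
set c := a :: _ in h1 h2 Uc; set f := next c in h2.
have fa : f a = h by rewrite /f /c /= eqxx.
have fx : f x = b.
  have E : c = (a :: h :: r) ++ x :: b :: q :: post' by rewrite /c /= cat_rcons.
  by move: Uc; rewrite /f E; apply: next_adjacent.
have fb : f b = q.
  have E : c = (a :: h :: rcons r x) ++ b :: q :: post' by [].
  by move: Uc; rewrite /f E; apply: next_adjacent.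
pose y := last q post'.
have fy : f y = a.
  have E : c = a :: rcons (h :: rcons r x ++ b :: belast q post') y.
    by rewrite /c /= rcons_cat rcons_cons -lastI.
  by move: Uc; rewrite /f E; apply: next_last.
pose z := last h r.
have fz : f z = x.
  have E : c = (a :: belast h r) ++ z :: x :: b :: q :: post'.
    by rewrite /c -rcons_cons (lastI h r) !cat_rcons.
  by move: Uc; rewrite /f E; apply: next_adjacent.
have fh : f h \in rcons r x.
  move: Uc; rewrite /f /c; clear; case: r => [|u r] Uc.
    by rewrite (@next_adjacent [:: a] _ h x) ?mem_rcons ?mem_head.
  by rewrite (@next_adjacent [:: a] _ h u) // mem_head.
have xp : x \in h :: rcons r x by rewrite in_cons mem_rcons mem_head orbT.
have zp : z \in h :: rcons r x by rewrite -rcons_cons mem_rcons inE mem_last orbT.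
have fhp : f h \in h :: rcons r x by rewrite in_cons fh orbT.
have hp : h \in h :: rcons r x by rewrite mem_head.
have yp : y \in q :: post' by apply: mem_last.
have qp : q \in q :: post' by apply: mem_head.
have cE t : (t \in c) = [|| t == a, t \in h :: rcons r x, t == b | t \in q :: post'].
  by rewrite -in_cons -mem_cat.
have inc t : t \in h :: rcons r x -> t \in c by rewrite cE => ->; rewrite orbT.
have yc : y \in c by rewrite cE yp !orbT.
have bc : b \in c by rewrite cE eqxx !orbT.
have ac : a \in c by rewrite cE eqxx.
have hx : h != x.
  by apply/eqP => hx; move: U; rewrite /= hx mem_cat mem_rcons mem_head.
have zx : z != x.
  apply/eqP => zx; move: Uc; rewrite /c -rcons_cons (lastI h r).
  rewrite -/z zx /= => /andP[_]; rewrite cat_rcons; set s := rcons _ _.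
  by rewrite cat_uniq /= /s mem_rcons mem_head andbF.
have bp t : t \in h :: rcons r x -> b < t by move/bpre.
have x_lt t : t \in h :: rcons r x -> f t \in h :: rcons r x -> t != x -> x < t.
  (* If [t < x], then [b < t < x < y] have values [q > f t > b > a], a 4321. *)
  move=> tp ftp; rewrite neq_ltn => /orP[tx|//].
  have [_] := h2 b t x y bc (inc _ tp) (inc _ xp) yc (bp _ tp) tx (sep _ _ xp yp); case.
  by rewrite fb fx fy ab (bp _ ftp) (sep _ _ ftp qp).
have xz : x < z by apply: x_lt => //; rewrite fz.
(* The letters [a < b < x < z] have values [h, q, b, x] with [b < x < h < q], a 3412. *)
have [+ _] := h2 a b x z ac bc (inc _ xp) (inc _ zp) ab (bp _ xp) xz; apply.
by rewrite fa fb fx fz (bp _ xp) (x_lt _ hp fhp hx) (sep _ _ hp qp).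
Qed.

(** * Enumeration of the good cycles and the Pell recurrence *)

(** The words [Y] for which [(a, Y)] is good; they do not depend on [a < b]. The blocks have [b]
    first, last, and strictly inside. The third is empty for [k = 0], since [b.+1, b] ends in [b]
    and is already in the second. *)
Fixpoint good_tails (b m : nat) : seq (seq nat) :=
  match m with
  | 0 => [:: [::]]
  | 1 => [:: [:: b]]
  | (k.+1 as l).+1 =>
      [seq b :: Y | Y <- good_tails b.+1 l]
      ++ [seq rcons Y b | Y <- good_tails b.+1 l]
      ++ (if k is 0 then [::]
          else [seq b.+1 :: b :: Y | Y <- good_tails b.+2 k])
  end.

Lemma good_tails_rec b k :
  good_tails b k.+2 =
    [seq b :: Y | Y <- good_tails b.+1 k.+1]
    ++ [seq rcons Y b | Y <- good_tails b.+1 k.+1]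
    ++ (if k is 0 then [::]
        else [seq b.+1 :: b :: Y | Y <- good_tails b.+2 k]).
Proof. by []. Qed.

(** For [m = 0] the empty word is listed although [pell 0 = 0], hence the bound. *)
Lemma size_good_tails b m : 0 < m -> size (good_tails b m) = pell m.
Proof.
(* The recurrence reaches back two steps and shifts [b], so two consecutive sizes are carried for
   all [b]. *)
suff H k : (forall b, size (good_tails b k.+1) = pell k.+1) /\
           (forall b, size (good_tails b k.+2) = pell k.+2).
  by case: m => // m _; case: (H m) => + _; apply.
elim: k => [|k [IH1 IH2]]; first by split.
split=> // {}b; have -> : pell k.+3 = 2 * pell k.+2 + pell k.+1 by [].
rewrite good_tails_rec.
by rewrite !size_cat !size_map IH1 !IH2; lia.
Qed.

Lemma good_cycle1 a : good_cycle [:: a].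
Proof.
split=> [x y z /size_subseq //|x1 x2 x3 x4].
by rewrite !inE => /eqP-> /eqP->; rewrite ltnn.
Qed.

Lemma mem_good_tails m a b Y : a < b ->
  (Y \in good_tails b m) <-> (perm_eq Y (iota b m) /\ good_cycle (a :: Y)).
Proof.
(* Strong induction with [a] and [b] general: the shorter cycles start with [b], [a] or [b.+1]. *)
have [N] := ubnP m; elim: N m a b Y => // N IH [|[|k]] a b Y ltN ab.
- rewrite inE; split=> [/eqP->|[/perm_small_eq -> //]].
  by split=> //; apply: good_cycle1.
- rewrite inE; split=> [/eqP->|[/perm_small_eq -> //]].
  by split=> //; apply/good_cycle_first=> //; apply: good_cycle1.
have gtP c n X : perm_eq X (iota c.+1 n) -> uniq X /\ all (ltn c) X.
  move=> pX; rewrite (perm_uniq pX) iota_uniq; split=> //.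
  by apply/allP => x; rewrite (perm_mem pX) mem_iota => /andP[].
rewrite good_tails_rec !mem_cat; split.
  case/or3P => [/mapP[X HX ->]|/mapP[X HX ->]|].
  - have /(IH k.+1 b b.+1 X) := HX; case=> // pX gX; have [U bX] := gtP _ _ _ pX.
    by split; [rewrite /= perm_cons|apply/good_cycle_first].
  - have /(IH k.+1 a b.+1 X) := HX; case=> //; first by lia.
    move=> pX gX; have [U bX] := gtP _ _ _ pX.
    by split; [rewrite perm_rcons /= perm_cons|apply/good_cycle_last].
  case: k => // k in IH ltN * => /mapP[X HX ->].
  have /(IH k.+1 b.+1 b.+2 X) := HX; case=> //; first by lia.
  move=> pX gX; have [U bX] := gtP _ _ _ pX.
  split.
    rewrite -[b.+1 :: _]/([:: b.+1] ++ [:: b] ++ X) perm_catCA /= !perm_cons.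
    exact: pX.
  apply/good_cycle_pair=> //; apply/eqP => X0.
  by have := perm_size pX; rewrite X0.
case=> pY gY; have bY : b \in Y by rewrite (perm_mem pY) mem_iota; lia.
case/splitPr: bY pY gY => pre post pY gY.
have pX : perm_eq (pre ++ post) (iota b.+1 k.+1).
  by move: pY; rewrite -cat1s perm_catCA /= perm_cons.
have [U bX] := gtP _ _ _ pX.
have [pre0|pre0] := eqVneq pre [::].
  rewrite {}pre0 /= in pX gY U bX *; apply/or3P; constructor 1.
  apply: map_f; apply/(IH k.+1 b b.+1) => //; split=> //.
  exact/(good_cycle_first ab bX U).
have [post0|post0] := eqVneq post [::].
  rewrite {}post0 cats0 cats1 /= in pX gY U bX *; apply/or3P; constructor 2.
  apply: map_f; apply/(IH k.+1 a b.+1) => //; first by lia.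
  by split=> //; apply/(good_cycle_last ab bX U).
have [pre1 sep] := good_cycle_middle ab bX U pre0 post0 gY.
case: pre pre1 => // h [] // _ in pX gY U bX sep {pre0 pY} *.
(* The letter [b.+1] must occur; in [post] it would exceed [h], which itself exceeds [b]. *)
have hb : h = b.+1.
  have : b.+1 \in [:: h] ++ post by rewrite (perm_mem pX) mem_iota; lia.
  rewrite mem_cat inE => /orP[/eqP//|bp].
  have := sep h _ (mem_head _ _) bp.
  by case/andP: bX => /=; lia.
rewrite {}hb /= in pX gY U bX sep *.
case/andP: U => _ U.
rewrite perm_cons in pX; have [_ bX'] := gtP _ _ _ pX.
case: k => [|k] in IH ltN pX *.
  by move: post0; rewrite (perm_small_eq _ pX).
apply/or3P; constructor 3; apply: map_f; apply/(IH k.+1 b.+1 b.+2) => //; first by lia.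
by split=> //; apply/(good_cycle_pair ab bX' U post0).
Qed.

Lemma perm_good_tails m b Y : Y \in good_tails b m.+1 -> 0 < b -> perm_eq Y (iota b m.+1).
Proof. by move=> HY b0; case: (mem_good_tails m.+1 Y b0) => /(_ HY) []. Qed.

(** The blocks are disjoint: [b] is the first letter only in the first block and the last letter
    only in the second. *)
Lemma uniq_good_tails m b : 0 < b -> uniq (good_tails b m).
Proof.
have [N] := ubnP m; elim: N m b => // N IH [|[|k]] b ltN b0 //.
have rinj : injective (fun Y : seq nat => rcons Y b).
  by move=> X Y /= /rcons_inj[].
rewrite good_tails_rec !cat_uniq !map_inj_uniq ?IH //; try by [lia | move=> X Y /= [->]].
rewrite /= has_cat negb_or -andbA; apply/and4P; split.
- apply/hasPn => Z /mapP[Y HY ->]; apply/mapP => -[X HX].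
  have := perm_good_tails HY; case: Y HY => [|y Y] HY /= pY.
    by have := perm_size (pY isT).
  case=> yb _; have : y \in iota b.+1 k.+1 by rewrite -(perm_mem (pY isT)) mem_head.
  by rewrite mem_iota; lia.
- case: k {IH ltN} => // k; apply/hasPn => Z /mapP[Y HY ->]; apply/mapP => -[X HX].
  by case; lia.
- case: k {IH ltN} => // k; apply/hasPn => Z /mapP[Y HY ->]; apply/mapP => -[X HX].
  have := perm_good_tails HY isT.
  case/lastP: Y HY => [|Y y] HY pY; first by have := perm_size pY.
  rewrite -!rcons_cons => /rcons_inj[_ yb].
  have : y \in iota b.+2 k.+1 by rewrite -(perm_mem pY) mem_rcons mem_head.
  by rewrite mem_iota; lia.
case: k IH ltN => // k IH ltN; rewrite map_inj_uniq ?IH //; first by lia.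
by move=> X Y /= [->].
Qed.

(** * Pattern containment in terms of positions *)

(** Functions on naturals replace those on ordinals, so that an occurrence can be given by a plain
    list of positions. *)
Lemma containsP sigma w :
  reflect (exists2 f : nat -> nat, (forall s, s < size sigma -> f s < size w) &
      (forall s t, s < t -> t < size sigma -> f s < f t /\
        (nth 0 w (f t) < nth 0 w (f s)) = (nth 0 sigma t < nth 0 sigma s)))
    (contains sigma w).
Proof.
apply: (iffP existsP) => [[i /forallP H]|[f fw H]].
  exists (fun s => if insub s is Some s' then val (i s') else 0).
    by move=> s hs; rewrite (insubT (fun k => k < size sigma) hs) /= ltn_ord.
  move=> s t st ht; have hs := ltn_trans st ht.
  rewrite (insubT (fun k => k < size sigma) hs) (insubT (fun k => k < size sigma) ht) /=.
  have /forallP /(_ (Ordinal ht)) /implyP /(_ st) /andP[-> /eqP ->] := H (Ordinal hs).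
  by [].
exists [ffun s : 'I_(size sigma) => Ordinal (fw s (ltn_ord s))].
apply/forallP => s; apply/forallP => t; apply/implyP => st; rewrite !ffunE /=.
by have [-> ->] := H s t st (ltn_ord t); rewrite eqxx.
Qed.

Lemma contains3P p q r w :
  reflect (exists i j k, [/\ i < j, j < k & k < size w] /\
      [/\ (nth 0 w j < nth 0 w i) = (q < p), (nth 0 w k < nth 0 w i) = (r < p)
        & (nth 0 w k < nth 0 w j) = (r < q)])
    (contains [:: p; q; r] w).
Proof.
apply: (iffP (containsP _ _)) => [[f fw H]|[i [j [k [[ij jk kw] [e1 e2 e3]]]]]].
  exists (f 0), (f 1), (f 2).
  have [l1 ->] := H 0 1 isT isT; have [l2 ->] := H 0 2 isT isT.
  have [l3 ->] := H 1 2 isT isT.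
  by split=> //; split=> //; apply: fw.
exists (nth 0 [:: i; j; k]) => [[|[|[|s]]] //= _|]; try by lia.
by move=> [|[|[|s]]] [|[|[|t]]] //= _ _; split=> //; lia.
Qed.

Lemma contains4P p q r s w :
  reflect (exists i j k l, [/\ i < j, j < k, k < l & l < size w] /\
      [/\ (nth 0 w j < nth 0 w i) = (q < p), (nth 0 w k < nth 0 w i) = (r < p)
        & (nth 0 w l < nth 0 w i) = (s < p)] /\
      [/\ (nth 0 w k < nth 0 w j) = (r < q), (nth 0 w l < nth 0 w j) = (s < q)
        & (nth 0 w l < nth 0 w k) = (s < r)])
    (contains [:: p; q; r; s] w).
Proof.
apply: (iffP (containsP _ _)) => [[f fw H]|
  [i [j [k [l [[ij jk kl lw] [[e1 e2 e3] [e4 e5 e6]]]]]]]].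
  exists (f 0), (f 1), (f 2), (f 3).
  have [l1 ->] := H 0 1 isT isT; have [l2 ->] := H 0 2 isT isT.
  have [l3 ->] := H 0 3 isT isT; have [l4 ->] := H 1 2 isT isT.
  have [l5 ->] := H 1 3 isT isT; have [l6 ->] := H 2 3 isT isT.
  by split=> //; split=> //; apply: fw.
exists (nth 0 [:: i; j; k; l]) => [[|[|[|[|t]]]] //= _|]; try by lia.
by move=> [|[|[|[|t]]]] [|[|[|[|u]]]] //= _ _; split=> //; lia.
Qed.

(** * Cyclic permutations and their orbit words *)

Lemma is_cyclicP m (p : 'S_m.+1) :
  reflect (porbit p ord0 = [set: 'I_m.+1]) (is_cyclic p).
Proof.
apply: (iffP cards1P) => [[A HA]|H].
  apply/setP => x; rewrite inE.
  have inA y : porbit p y = A by apply/set1P; rewrite -HA imset_f.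
  by rewrite inA -(inA x) porbit_id.
exists [set: 'I_m.+1]; apply/setP => A; rewrite inE; apply/imsetP/eqP => [[x _ ->]|->].
  by rewrite -H; apply/eqP; rewrite eq_porbit_mem H inE.
by exists ord0; rewrite ?H.
Qed.

(** The cycle form with letters lowered by one: letters are then the values of ordinals, and the
    word starts with [0]. *)
Definition orbit_word m (p : 'S_m.+1) : seq nat :=
  [seq val i | i <- traject p ord0 m.+1].

Lemma size_orbit_word m (p : 'S_m.+1) : size (orbit_word p) = m.+1.
Proof. by rewrite size_map size_traject. Qed.

Lemma nth_orbit_word m (p : 'S_m.+1) i :
  i < m.+1 -> nth 0 (orbit_word p) i = iter i p ord0.
Proof. by move=> hi; rewrite (nth_map ord0) ?size_traject // nth_traject. Qed.

Lemma nth_cycle_form m (p : 'S_m.+1) i :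
  i < m.+1 -> nth 0 (cycle_form p) i = (iter i p ord0).+1.
Proof. by move=> hi; rewrite (nth_map ord0) ?size_traject // nth_traject. Qed.

Lemma size_cycle_form m (p : 'S_m.+1) : size (cycle_form p) = m.+1.
Proof. by rewrite size_map size_traject. Qed.

Lemma nth_one_line n (p : 'S_n) (i : 'I_n) : nth 0 (one_line p) i = (p i).+1.
Proof. by rewrite (nth_map i) ?size_enum_ord // nth_ord_enum. Qed.

Lemma size_one_line n (p : 'S_n) : size (one_line p) = n.
Proof. by rewrite size_map size_enum_ord. Qed.

Section Cyclic.
Variables (m : nat) (p : 'S_m.+1).
Hypothesis cp : is_cyclic p.

Lemma card_porbit_cyclic : #|porbit p ord0| = m.+1.
Proof. by have /is_cyclicP -> := cp; rewrite cardsT card_ord. Qed.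

Lemma traject_cyclic_uniq : uniq (traject p ord0 m.+1).
Proof. by have := uniq_traject_porbit p ord0; rewrite card_porbit_cyclic. Qed.

Lemma mem_traject_cyclic x : x \in traject p ord0 m.+1.
Proof.
by rewrite -[X in traject _ _ X]card_porbit_cyclic -porbit_traject (is_cyclicP _ cp) inE.
Qed.

Lemma iter_cyclic : iter m.+1 p ord0 = ord0.
Proof. by have := iter_porbit p ord0; rewrite card_porbit_cyclic. Qed.

Lemma orbit_word_uniq : uniq (orbit_word p).
Proof. by rewrite map_inj_uniq ?traject_cyclic_uniq //; apply: val_inj. Qed.

Lemma orbit_word_perm : perm_eq (orbit_word p) (iota 0 m.+1).
Proof.
apply: uniq_perm; rewrite ?orbit_word_uniq ?iota_uniq // => x.
rewrite mem_iota /= add0n; apply/mapP/idP => [[i _ ->]|hx]; first exact: ltn_ord.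
by exists (Ordinal hx); rewrite ?mem_traject_cyclic.
Qed.

Lemma next_orbit_word (i : 'I_m.+1) : next (orbit_word p) i = p i.
Proof.
have cyc : fcycle p (traject p ord0 m.+1).
  rewrite /=; have := iter_cyclic; rewrite iterSr => {3}<-.
  by rewrite -trajectSr fpath_traject.
rewrite (@next_map _ _ val val_inj _ traject_cyclic_uniq).
by rewrite (nextE cyc (mem_traject_cyclic i)).
Qed.

Lemma nth_one_line_cyclic x :
  x < m.+1 -> nth 0 (one_line p) x = (next (orbit_word p) x).+1.
Proof.
by move=> hx; rewrite -[x]/(nat_of_ord (Ordinal hx)) nth_one_line next_orbit_word.
Qed.

Lemma mem_orbit_word x : (x \in orbit_word p) = (x < m.+1).
Proof. by rewrite (perm_mem orbit_word_perm) mem_iota. Qed.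

End Cyclic.

Lemma orbit_word_inj m :
  {in [pred p : 'S_m.+1 | is_cyclic p] &, injective (@orbit_word m)}.
Proof.
move=> p q cp cq E; apply/permP => i; apply: val_inj.
by rewrite /= -(next_orbit_word cp) -(next_orbit_word cq) E.
Qed.

(** * Translation of the avoidance conditions to orbit words *)

Lemma avoids_one_lineP m (p : 'S_m.+1) : is_cyclic p ->
  all (fun sigma => avoids sigma (one_line p)) [:: [:: 3; 4; 1; 2]; [:: 4; 3; 2; 1]]
  <-> avoids_3412_4321 (orbit_word p) (next (orbit_word p)).
Proof.
move=> cp; rewrite /all andbT /avoids.
have nthE := nth_one_line_cyclic cp; have memE := mem_orbit_word cp.
(* [contains] only records whether a descent holds; distinct values turn its failure into a strict
   ascent. *)
have neq x y : x < y -> next (orbit_word p) x != next (orbit_word p) y.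
  move=> xy; rewrite (inj_eq (can_inj (prev_next (orbit_word_uniq cp)))).
  by rewrite (ltn_eqF xy).
split=> [/andP[/contains4P h1 /contains4P h2] x1 x2 x3 x4|H].
  rewrite !memE => b1 b2 b3 b4 l1 l2 l3.
  split=> h; [apply: h1|apply: h2]; exists x1, x2, x3, x4;
    rewrite size_one_line !nthE //; move: h; clear - l1 l2 l3 b4;
    by move=> [? [? ?]]; split; [split | split; split; lia].
apply/andP; split; apply/contains4P => -[i [j [k [l [[ij jk kl]]]]]];
  rewrite size_one_line => lm; have km := ltn_trans kl lm;
  have jm := ltn_trans jk km; have im := ltn_trans ij jm;
  rewrite !nthE // => -[[e1 e2 e3] [e4 e5 e6]];
  have := H i j k l; rewrite !memE => /(_ im jm km lm ij jk kl);
  move: e1 e2 e3 e4 e5 e6 (neq _ _ ij) (neq _ _ jk) (neq _ _ kl); clear; lia.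
Qed.

Lemma subseq_consP (T : eqType) (x0 x : T) t s :
  reflect (exists i, [/\ i < size s, nth x0 s i = x & subseq t (drop i.+1 s)])
    (subseq (x :: t) s).
Proof.
apply: (iffP idP) => [|[i [hi <- sub]]]; last first.
  rewrite -{2}(cat_take_drop i s) (drop_nth x0 hi).
  by apply: subseq_trans (suffix_subseq _ _); rewrite /= eqxx.
elim: s => // y s IH /=; case: eqP => [->|_] sub; first by exists 0; rewrite drop0.
by have [i [hi hx hs]] := IH sub; exists i.+1.
Qed.

Lemma subseq3P (x y z : nat) s :
  reflect (exists i j k, [/\ i < j, j < k & k < size s] /\
             [/\ nth 0 s i = x, nth 0 s j = y & nth 0 s k = z])
    (subseq [:: x; y; z] s).
Proof.
apply: (iffP (subseq_consP 0 _ _ _)).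
  case=> i [hi <- /(subseq_consP 0)[j [+ <- /(subseq_consP 0)[k [+ <- _]]]]].
  rewrite !drop_drop !size_drop !nth_drop !ltn_subRL => hj hk.
  by exists i, (i.+1 + j), (j.+1 + i.+1 + k); split; split=> //; lia.
case=> i [j [k [[ij jk ks] [<- <- <-]]]]; have js := ltn_trans jk ks.
exists i; split=> //; first exact: ltn_trans js.
apply/(subseq_consP 0); exists (j - i.+1); rewrite size_drop nth_drop; split.
- by apply: ltn_sub2r => //; apply: leq_ltn_trans js.
- by rewrite subnKC.
have e : (j - i.+1).+1 + i.+1 = j.+1 by lia.
apply/(subseq_consP 0); exists (k - j.+1); rewrite drop_drop e.
rewrite size_drop nth_drop sub0seq subnKC //; split=> //.
by apply: ltn_sub2r => //; apply: leq_ltn_trans ks.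
Qed.

Lemma avoids_cycle_form312P m (p : 'S_m.+1) : is_cyclic p ->
  avoids [:: 3; 1; 2] (cycle_form p) <-> avoids_312 (orbit_word p).
Proof.
move=> cp; rewrite /avoids; split.
  move/contains3P => h x y z /subseq3P[i [j [k [[ij jk ks] [<- <- <-]]]]].
  rewrite size_orbit_word in ks => -[yz zx]; apply: h; exists i, j, k.
  move: yz zx; rewrite size_cycle_form ks ij jk !nth_cycle_form ?nth_orbit_word; try lia.
  by move=> ? ?; split; split; lia.
move=> h; apply/contains3P => -[i [j [k [[ij jk ks] [e1 e2 e3]]]]].
rewrite size_cycle_form in ks.
apply: (h (nth 0 (orbit_word p) i) (nth 0 (orbit_word p) j) (nth 0 (orbit_word p) k)).
  by apply/subseq3P; exists i, j, k; rewrite size_orbit_word.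
have : nth 0 (orbit_word p) j != nth 0 (orbit_word p) k.
  by rewrite nth_uniq ?orbit_word_uniq ?size_orbit_word //; lia.
by move: e1 e2 e3; rewrite !nth_cycle_form ?nth_orbit_word; lia.
Qed.

(** The permutation is the successor map of [c], injective because [c] has no repeated letter. *)
Lemma orbit_word_surj m c : perm_eq c (iota 0 m.+1) -> head 1 c = 0 ->
  exists2 p : 'S_m.+1, is_cyclic p & orbit_word p = c.
Proof.
move=> pc hc; have Uc : uniq c by rewrite (perm_uniq pc) iota_uniq.
have mc x : (x \in c) = (x < m.+1) by rewrite (perm_mem pc) mem_iota.
have sc : size c = m.+1 by rewrite (perm_size pc) size_iota.
have c0 : nth 0 c 0 = 0 by case: c hc {pc Uc mc sc}.
have cS i : i.+1 < m.+1 -> next c (nth 0 c i) = nth 0 c i.+1.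
  move=> hi; rewrite next_nth mem_nth ?sc ?(ltnW hi) // index_uniq ?sc ?(ltnW hi) //.
  case: c sc {pc hc Uc mc c0} => //= x c [sc].
  by apply: set_nth_default; rewrite sc.
have lt (i : 'I_m.+1) : next c i < m.+1 by rewrite -mc mem_next mc.
have inj : injective (fun i => Ordinal (lt i)).
  by move=> i j [] /(can_inj (prev_next Uc)) /val_inj.
pose p := perm inj.
have it i : i < m.+1 -> val (iter i p ord0) = nth 0 c i.
  elim: i => [_|i IH hi]; first by rewrite c0.
  by rewrite iterS permE /= IH ?(ltnW hi) // cS.
have E : orbit_word p = c.
  apply: (@eq_from_nth _ 0); rewrite size_orbit_word // => i hi.
  by rewrite nth_orbit_word // it.
exists p => //; apply/is_cyclicP/setP => x; rewrite inE.
have : val x \in orbit_word p by rewrite E mc ltn_ord.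
case/mapP => y /trajectP[i _ ->] /val_inj xE.
by rewrite xE -permX mem_porbit.
Qed.

(** * The count for 312 *)

Lemma a_num_312 m : 0 < m ->
  a_num m.+1 [:: [:: 3; 4; 1; 2]; [:: 4; 3; 2; 1]] [:: 3; 1; 2] = pell m.
Proof.
move=> m0; rewrite -(size_good_tails 1 m0) /a_num cardE.
set A := A_set _ _ _.
have AP p : reflect (is_cyclic p /\ good_cycle (orbit_word p)) (p \in A).
  rewrite inE; apply: (iffP and3P) => [[cp h1 h2]|[cp [h2 h1]]].
    by split=> //; split; [apply/avoids_cycle_form312P|apply/avoids_one_lineP].
  by split=> //; [apply/avoids_one_lineP|apply/avoids_cycle_form312P].
(* Both sides become lengths of duplicate-free lists of words with the same members, the case
   [a = 0], [b = 1] of the enumeration. *)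
rewrite -(size_map (@orbit_word m)) -(size_map (cons 0) (good_tails 1 m)).
apply/perm_size/uniq_perm.
- rewrite map_inj_in_uniq ?enum_uniq // => p q.
  by rewrite !mem_enum => /AP[cp _] /AP[cq _]; apply: orbit_word_inj.
- by rewrite map_inj_uniq ?uniq_good_tails // => X Y [].
move=> c; apply/mapP/mapP => [[p] | [Y HY ->]].
  rewrite mem_enum => /AP[cp gp] ->.
  have E : orbit_word p = 0 :: behead (orbit_word p) by [].
  exists (behead (orbit_word p)) => //.
  apply/(@mem_good_tails m 0 1) => //; split; last by rewrite -E.
  by have := orbit_word_perm cp; rewrite E perm_cons.
have [pY gY] := iffLR (@mem_good_tails m 0 1 Y isT) HY.
have [|//|p cp E] := @orbit_word_surj m (0 :: Y); first by rewrite /= perm_cons.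
by exists p => //; rewrite mem_enum; apply/AP; rewrite E.
Qed.

(** * Symmetry under inversion *)

(** Inversion exchanges positions and values, and both patterns are involutions. *)
Lemma contains_one_lineV n (p : 'S_n) sigma :
  sigma \in [:: [:: 3; 4; 1; 2]; [:: 4; 3; 2; 1]] ->
  contains sigma (one_line p) -> contains sigma (one_line p^-1).
Proof.
move=> Hs.
have val_nth (q : 'S_n) x (hx : x < n) : nth 0 (one_line q) x = (q (Ordinal hx)).+1.
  by rewrite -[x]/(val (Ordinal hx)) nth_one_line.
have neq (x y : 'I_n) : x < y -> p x != p y :> nat.
  by move=> xy; rewrite (inj_eq val_inj) (inj_eq perm_inj) neq_ltn xy.
have V x (hx : x < n) : nth 0 (one_line p^-1) (p (Ordinal hx)) = x.+1.
  by rewrite nth_one_line permK.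
move: Hs; rewrite !inE => /orP[]/eqP-> /contains4P
  [i [j [k [l [[ij jk kl]]]]]]; rewrite size_one_line => ln;
  have [kn jn] := (ltn_trans kl ln, ltn_trans jk (ltn_trans kl ln));
  rewrite (val_nth p i (ltn_trans ij jn)) (val_nth p j jn) (val_nth p k kn) (val_nth p l ln);
  move=> [[e1 e2 e3] [e4 e5 e6]]; apply/contains4P;
  have := neq (Ordinal (ltn_trans ij jn)) (Ordinal jn) ij;
  have := neq (Ordinal jn) (Ordinal kn) jk;
  have := neq (Ordinal kn) (Ordinal ln) kl.
(* The values of the occurrence in increasing order: in 3412 the smallest two stand at [k] and
   [l]. *)
- exists (p (Ordinal kn)), (p (Ordinal ln)), (p (Ordinal (ltn_trans ij jn))), (p (Ordinal jn)).
  by rewrite !V size_one_line => *; split; [split; rewrite ?ltn_ord // | split; split]; lia.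
exists (p (Ordinal ln)), (p (Ordinal kn)), (p (Ordinal jn)), (p (Ordinal (ltn_trans ij jn))).
by rewrite !V size_one_line => *; split; [split; rewrite ?ltn_ord // | split; split]; lia.
Qed.

Lemma iter_permV m (p : 'S_m.+1) i : is_cyclic p -> i <= m.+1 ->
  iter i (p^-1)%g ord0 = iter (m.+1 - i) p ord0.
Proof.
move=> cp; elim: i => [_|i IH hi]; first by rewrite subn0 iter_cyclic.
by rewrite iterS IH ?(ltnW hi) // subSS subSn //= permK.
Qed.

Lemma is_cyclicV n (p : 'S_n) : is_cyclic p^-1 = is_cyclic p.
Proof. by rewrite /is_cyclic porbitsV. Qed.

(* The cycle form of the inverse is [1] followed by the reversal of the rest;
   [1] takes part in no occurrence of a pattern whose first letter is not its
   smallest. *)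
Lemma contains_cycle_formV m (p : 'S_m.+1) x y z :
  is_cyclic p -> y < x -> y < z -> x != z ->
  contains [:: x; y; z] (cycle_form p) -> contains [:: z; y; x] (cycle_form p^-1).
Proof.
move=> cp yx yz xz /contains3P[i [j [k]]]; rewrite size_cycle_form => -[[ij jk km]].
have jm := ltn_trans jk km; have im := ltn_trans ij jm.
rewrite !nth_cycle_form // => -[e1 e2 e3].
have i0 : 0 < i by case: i e1 {ij im e2} => //; rewrite yx.
have neq u v : u < v -> v < m.+1 -> iter u p ord0 != iter v p ord0 :> nat.
  move=> uv vm; have um := ltn_trans uv vm.
  rewrite -!nth_orbit_word // nth_uniq ?size_orbit_word ?orbit_word_uniq //.
  by rewrite (ltn_eqF uv).
(* The letter at position [i] moves to [m.+1 - i], a valid position because [0 < i]. *)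
apply/contains3P; exists (m.+1 - k), (m.+1 - j), (m.+1 - i).
have j0 := ltn_trans i0 ij; have k0 := ltn_trans j0 jk.
rewrite size_cycle_form !nth_cycle_form ?ltn_subrL ?i0 ?j0 ?k0 //.
rewrite !iter_permV ?leq_subr // !subKn ?(ltnW im) ?(ltnW jm) ?(ltnW km) //.
split; first by split; lia.
move: (neq _ _ ij jm) (neq _ _ jk km) (neq _ _ (ltn_trans ij jk) km) e1 e2 e3 yx yz xz.
by clear; split; lia.
Qed.

Lemma a_num_inverse m :
  a_num m.+1 [:: [:: 3; 4; 1; 2]; [:: 4; 3; 2; 1]] [:: 2; 1; 3]
  = a_num m.+1 [:: [:: 3; 4; 1; 2]; [:: 4; 3; 2; 1]] [:: 3; 1; 2].
Proof.
(* The set for 213 is replaced by its image under inversion, which is shown to be the set for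
   312. *)
rewrite /a_num -(card_imset _ (@invg_inj 'S_m.+1)).
congr #|pred_of_set _|; apply/setP => p.
have containsV (q : 'S_m.+1) sigma : sigma \in [:: [:: 3; 4; 1; 2]; [:: 4; 3; 2; 1]] ->
    contains sigma (one_line q^-1) = contains sigma (one_line q).
  move=> Hs; apply/idP/idP; last exact: contains_one_lineV.
  by rewrite -{2}[q]invgK; apply: contains_one_lineV.
rewrite -[p in LHS]invgK (mem_imset _ _ invg_inj) !inE is_cyclicV.
case cp: (is_cyclic p) => //; rewrite /all /avoids !andTb !containsV ?inE ?eqxx ?orbT //.
congr (_ && ~~ _); apply/idP/idP; last by apply: contains_cycle_formV.
by rewrite -{2}[p]invgK; apply: contains_cycle_formV; rewrite ?is_cyclicV.
Qed.

Theorem theorem3p8 (n : nat) (hn : 2 <= n) :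
  a_num n [:: [:: 3; 4; 1; 2]; [:: 4; 3; 2; 1]] [:: 2; 1; 3]
    = a_num n [:: [:: 3; 4; 1; 2]; [:: 4; 3; 2; 1]] [:: 3; 1; 2]
  /\ a_num n [:: [:: 3; 4; 1; 2]; [:: 4; 3; 2; 1]] [:: 3; 1; 2]
    = pell n.-1.
Proof.
by case: n hn => [|[|m]] // _; rewrite a_num_inverse a_num_312.
Qed.
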